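(* Let $\mathcal L$ be a language containing the binary predicate $<$, and let $\mathcal M=(M,<,\ldots)$ be a definably complete locally o-minimal $\mathcal L$-structure. Then the pair $(M,\operatorname{discl}_{\mathcal M})$ is a pregeometry.
   Context: ''Definable'' means definable in the given structure with parameters unless the parameters are specified. Let $\mathcal M=(M,<,\ldots)$ be an expansion of a dense linear order without endpoints; $M$ carries the order topology. An open interval is a nonempty set $(a,b)=\{x\in M : a<x<b\}$ with $a,b\in M\cup\{\pm\infty\}$. $\mathcal M$ is locally o-minimal if, for every definable subset $X$ of $M$ and every point $a\in M$, there exists an open interval $I$ containing $a$ such that $X\cap I$ is a finite union of points and open intervals. $\mathcal M$ is definably complete if every definable subset of $M$ has a supremum and an infimum in $M\cup\{\pm\infty\}$. Discrete closure: for $A\subseteq M$, $\operatorname{discl}_{\mathcal M}(A)$ is the set of points $x\in M$ for which there is an $\mathcal L(A)$-formula $\phi(t)$ in one free variable such that the set $\phi(\mathcal M)=\{t\in M : \mathcal M\models\phi(t)\}$ contains $x$ and is discrete (in the subspace topology) and closed in $M$. Here an $\mathcal L(A)$-formula is an $\mathcal L$-formula with parameters from $A$. Pregeometry: for a set $S$ and a map $\operatorname{cl}:\mathcal P(S)\to\mathcal P(S)$ on its power set, the pair $(S,\operatorname{cl})$ is a pregeometry if for every subset $A$ of $S$: (i) $A\subseteq\operatorname{cl}(A)$; (ii) $\operatorname{cl}(\operatorname{cl}(A))=\operatorname{cl}(A)$; (iii) (exchange property) for any $a,b\in S$, if $a\in\operatorname{cl}(A\cup\{b\})\setminus\operatorname{cl}(A)$,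 then $b\in\operatorname{cl}(A\cup\{a\})$; (iv) for any $a\in\operatorname{cl}(A)$, there exists a finite subset $Y$ of $A$ such that $a\in\operatorname{cl}(Y)$. *)

(* Defs.v *)
From HB Require Import structures.
From mathcomp Require Import all_boot all_order interval.
From mathcomp Require Import all_classical topology.

Set Implicit Arguments.
Unset Strict Implicit.
Unset Printing Implicit Defensive.

Import Order.TTheory.
Local Open Scope classical_set_scope.
Local Open Scope order_scope.

(** [fun_sym n] and [rel_sym n] are the [n]-ary symbols; constants are nullary
    function symbols. *)
Record language := Language {
  fun_sym : nat -> Type;
  rel_sym : nat -> Type }.

(** Well-scoped de Bruijn syntax: [formula L n] is the type of formulas whose
    free variables are among the [n] variables ['I_n]; [FEx] binds the variable
    [ord0], the others being shifted by [lift ord0]. Equality is a logical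
    symbol, and the remaining connectives are the usual classical
    abbreviations. *)
Inductive term (L : language) (n : nat) :=
  | TVar of 'I_n
  | TApp k of fun_sym L k & ('I_k -> term L n).

Inductive formula (L : language) : nat -> Type :=
  | FEq n of term L n & term L n : formula L n
  | FRel n k of rel_sym L k & ('I_k -> term L n) : formula L n
  | FNot n of formula L n : formula L n
  | FAnd n of formula L n & formula L n : formula L n
  | FEx n of formula L n.+1 : formula L n.

Record structure (L : language) (M : Type) := Structure {
  fun_interp : forall n, fun_sym L n -> ('I_n -> M) -> M;
  rel_interp : forall n, rel_sym L n -> ('I_n -> M) -> Prop }.

Fixpoint eval (L : language) (M : Type) (S : structure L M) (n : nat)
    (v : 'I_n -> M) (t : term L n) : M :=
  match t with
  | TVar i => v i
  | TApp _ f args => fun_interp S f (fun j => eval S v (args j))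
  end.

Definition env_cons (M : Type) (n : nat) (a : M) (v : 'I_n -> M)
    (i : 'I_n.+1) : M :=
  if unlift ord0 i is Some j then v j else a.

Fixpoint sat (L : language) (M : Type) (S : structure L M) (n : nat)
    (phi : formula L n) : ('I_n -> M) -> Prop :=
  match phi with
  | FEq _ s t => fun v => eval S v s = eval S v t
  | FRel _ _ r args => fun v => rel_interp S r (fun j => eval S v (args j))
  | FNot _ p => fun v => ~ sat S p v
  | FAnd _ p q => fun v => sat S p v /\ sat S q v
  | FEx _ p => fun v => exists a, sat S p (env_cons a v)
  end.

(** The language L(A), with a new constant symbol for each element of [A], and
    the natural expansion of an L-structure to it. *)
Variant const_sym (M : Type) (A : set M) : nat -> Type :=
  | Const a of A a : const_sym A 0.

Definition const_val (M : Type) (A : set M) n (c : const_sym A n) : M :=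
  let: Const a _ := c in a.

Definition lang_with (L : language) (M : Type) (A : set M) : language :=
  Language (fun n => (fun_sym L n + const_sym A n)%type) (rel_sym L).

Definition struct_with (L : language) (M : Type) (S : structure L M)
    (A : set M) : structure (lang_with L A) M :=
  @Structure (lang_with L A) M
    (fun n f => match f with
                | inl g => fun_interp S g
                | inr c => fun _ => const_val c
                end)
    (fun n r => rel_interp S (r : rel_sym L n)).

(** phi(M), for an L(A)-formula phi in one free variable. *)
Definition solution_set (L : language) (M : Type) (S : structure L M)
    (A : set M) (phi : formula (lang_with L A) 1) : set M :=
  [set t | sat (struct_with S A) phi (fun _ => t)].

Definition definable (L : language) (M : Type) (S : structure L M)
    (X : set M) : Prop :=
  exists phi : formula (lang_with L [set: M]) 1, X = solution_set S phi.

Variant with_infty (T : Type) := NegInf | Fin of T | PosInf.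
Arguments NegInf {T}.
Arguments PosInf {T}.

Definition with_infty_code T (x : with_infty T) : option (option T) :=
  match x with
  | NegInf => None
  | PosInf => Some None
  | Fin a => Some (Some a)
  end.

Definition with_infty_decode T (x : option (option T)) : with_infty T :=
  match x with
  | None => NegInf
  | Some None => PosInf
  | Some (Some a) => Fin a
  end.

Lemma with_infty_codeK T : cancel (@with_infty_code T) (@with_infty_decode T).
Proof. by case. Qed.

HB.instance Definition _ (T : choiceType) :=
  Choice.copy (with_infty T) (can_type (@with_infty_codeK T)).

Section WithInftyOrder.
Context {d : Order.disp_t} {T : porderType d}.

Definition le_with_infty (x y : with_infty T) : bool :=
  match x, y with
  | NegInf, _ => true
  | _, PosInf => true
  | Fin a, Fin b => a <= b
  | _, _ => false
  end.

Fact le_with_infty_refl : reflexive le_with_infty.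
Proof. by case=> /=. Qed.

Fact le_with_infty_anti : antisymmetric le_with_infty.
Proof. by case=> [|a|] [|b|] //= /le_anti ->. Qed.

Fact le_with_infty_trans : transitive le_with_infty.
Proof. by case=> [|a|] [|b|] [|c|] //=; exact: le_trans. Qed.

HB.instance Definition _ := Order.Le_isPOrder.Build d (with_infty T)
  le_with_infty_refl le_with_infty_anti le_with_infty_trans.

End WithInftyOrder.

Definition dense_without_endpoints d (M : orderType d) : Prop :=
  [/\ forall x y : M, x < y -> exists z, x < z < y,
      forall x : M, exists y, y < x
    & forall x : M, exists y, x < y].

(** [itv_open_ends] holds of ]a, b[, ]-oo, b[, ]a, +oo[ and ]-oo, +oo[. *)
Definition open_interval d (M : orderType d) (I : set M) : Prop :=
  exists i : interval M, [/\ itv_open_ends i, I = [set` i] & I !=set0].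

Definition finite_union_points_intervals d (M : orderType d) (X : set M) :
    Prop :=
  exists F : set (set M),
    [/\ finite_set F,
        forall U, F U -> (exists p, U = [set p]) \/ open_interval U
      & X = \bigcup_(U in F) U].

Definition locally_o_minimal (L : language) d (M : orderType d)
    (S : structure L M) : Prop :=
  forall (X : set M) (a : M), definable S X ->
    exists I : set M,
      [/\ open_interval I, I a & finite_union_points_intervals (X `&` I)].

Definition definably_complete (L : language) d (M : orderType d)
    (S : structure L M) : Prop :=
  forall X : set M, definable S X ->
    supremums (@Fin M @` X) !=set0 /\ infimums (@Fin M @` X) !=set0.

(** [set_type X] carries the subspace topology. *)
Definition discrete_subset (T : topologicalType) (X : set T) : Prop :=
  forall U : set (set_type X), open U.

Definition discl (L : language) (M : topologicalType) (S : structure L M)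
    (A : set M) : set M :=
  [set x | exists phi : formula (lang_with L A) 1,
    [/\ solution_set S phi x, discrete_subset (solution_set S phi)
      & closed (solution_set S phi)]].

Definition pregeometry (T : Type) (cl : set T -> set T) : Prop :=
  forall A : set T,
    [/\ A `<=` cl A,
        cl (cl A) = cl A,
        forall a b : T,
          (cl (A `|` [set b]) `\` cl A) a -> cl (A `|` [set a]) b
      & forall a : T, cl A a ->
          exists Y : set T, [/\ finite_set Y, Y `<=` A & cl Y a]].

(* Main.v *)
(** In a definably complete locally o-minimal structure a definable subset of
    the line is discrete and closed iff it has empty interior ("thin"). Write a
    formula with a parameter [b] as a member of a family [Q b] of definable sets,
    and discard the members that are not thin.

    Idempotence: if [b] ranges over a thin set [D], the union of the thin sets
    [Q b] is thin. For a definable family that is a chain under inclusion this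
    follows by looking at the points entered for the first time to the right of
    an endpoint: they accumulate there, hence fill an interval, which is
    impossible for a chain. In general the unions over [D] cut off at [e] form a
    chain, and the least [e] where thinness is lost adds only one member.

    Exchange: if all fibers of a definable [X] in one direction are thin, then
    those in the other direction are thin outside a thin set. Otherwise one gets
    convex fibers [V t] with interior for [t] in an interval. By the monotonicity
    theorem the lower and the upper ends of [V t] are monotone in [t] on some
    subinterval; as no [y] lies in [V t] for an interval of [t], the [V t] are
    pairwise disjoint there. So their lower ends form a thin set, which indexes
    the subinterval by singletons, contradicting the first part. *)
Require Import Defs.
From mathcomp Require Import all_boot all_order interval.
From mathcomp Require Import all_classical topology.

Set Implicit Arguments.
Unset Strict Implicit.
Unset Printing Implicit Defensive.

Import Order.TTheory.
Local Open Scope classical_set_scope.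

(** * Renaming of free variables *)

Section Renaming.
Variables (L : language) (M : Type) (S : structure L M).

Fixpoint rename_term n m (f : 'I_n -> 'I_m) (t : term L n) : term L m :=
  match t with
  | TVar i => TVar L (f i)
  | TApp _ g args => TApp g (fun j => rename_term f (args j))
  end.

Definition lift_renaming n m (f : 'I_n -> 'I_m) (i : 'I_n.+1) : 'I_m.+1 :=
  if unlift ord0 i is Some j then lift ord0 (f j) else ord0.

Fixpoint rename n (phi : formula L n) :
    forall m, ('I_n -> 'I_m) -> formula L m :=
  match phi with
  | FEq _ s t => fun m f => FEq (rename_term f s) (rename_term f t)
  | FRel _ _ r args => fun m f => FRel r (fun j => rename_term f (args j))
  | FNot _ p => fun m f => FNot (rename p f)
  | FAnd _ p q => fun m f => FAnd (rename p f) (rename q f)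
  | FEx _ p => fun m f => FEx (rename p (lift_renaming f))
  end.

Lemma eval_rename n m (f : 'I_n -> 'I_m) (t : term L n) v :
  Defs.eval S v (rename_term f t) = Defs.eval S (v \o f) t.
Proof. by elim: t => //= k g args IH; congr fun_interp; apply/funext. Qed.

Lemma env_cons_lift n m (f : 'I_n -> 'I_m) (v : 'I_m -> M) a :
  env_cons a v \o lift_renaming f = env_cons a (v \o f).
Proof.
apply/funext => i; rewrite /env_cons /lift_renaming /=.
by case: (unliftP ord0 i) => [j|] _; rewrite ?liftK ?unlift_none.
Qed.

Lemma sat_rename n (phi : formula L n) m (f : 'I_n -> 'I_m) v :
  sat S (rename phi f) v = sat S phi (v \o f).
Proof.
elim: phi m f v => //= {n} [n s t|n k r args|n p IH|n p IHp q IHq|n p IH] m f v.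
- by rewrite !eval_rename.
- by congr rel_interp; apply/funext => j; rewrite eval_rename.
- by rewrite IH.
- by rewrite IHp IHq.
- by congr ex; apply/funext => a; rewrite IH env_cons_lift.
Qed.

End Renaming.

(** * Closure properties of definability over a parameter set *)

Section Definability.
Variables (L : language) (M : Type) (S : structure L M).

Definition lookup (v : nat -> M) (x : nat + M) : M :=
  match x with inl k => v k | inr a => a end.

Definition over (A : set M) (x : nat + M) : Prop :=
  if x is inr a then A a else True.

(** Predicates on environments [nat -> M] defined by an L-formula whose free
    variables are instantiated by variables of the environment or by parameters
    from [A]; this makes changes of the parameter set syntactically trivial. *)
Definition dfn (A : set M) (P : (nat -> M) -> Prop) : Prop :=
  exists N (phi : formula L N) (s : 'I_N -> nat + M),
    (forall i, over A (s i)) /\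
    forall v, P v = sat S phi (fun i => lookup v (s i)).

Definition dterm (A : set M) (t : (nat -> M) -> M) : Prop :=
  exists2 x, over A x & forall v, t v = lookup v x.

Definition dfn1 (A : set M) (X : M -> Prop) := dfn A (fun v => X (v 0)).
Definition dfn2 (A : set M) (X : M -> M -> Prop) :=
  dfn A (fun v => X (v 0) (v 1)).

Implicit Types (A B : set M) (P Q : (nat -> M) -> Prop).

Lemma dterm_var A k : dterm A (fun v => v k).
Proof. by exists (inl k). Qed.

Lemma dterm_cst A a : A a -> dterm A (fun=> a).
Proof. by exists (inr a). Qed.

Lemma dfn_subst A P (t : nat -> (nat -> M) -> M) : (forall k, dterm A (t k)) ->
  dfn A P -> dfn A (fun v => P (fun k => t k v)).
Proof.
move=> ht [N [phi [s [sA Ps]]]].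
have [x xP] : {x & forall k, over A (x k) /\ forall v, t k v = lookup v (x k)}.
  apply: (@choice _ _ (fun k y => over A y /\ forall v, t k v = lookup v y)).
  by move=> k; have [y] := ht k; exists y.
exists N, phi, (fun i => if s i is inl k then x k else s i); split=> [i|v].
  by case E: (s i) (sA i) => [k|a] //= _; have [] := xP k.
rewrite Ps; congr sat; apply/funext => i.
by case: (s i) => //= k; have [_ ->] := xP k.
Qed.

Lemma dfn_ext A P Q : (forall v, P v <-> Q v) -> dfn A P -> dfn A Q.
Proof. by move=> PQ; congr dfn; apply/funext => v; apply/propext. Qed.

Lemma dfn1_app A (X : M -> Prop) t :
  dfn1 A X -> dterm A t -> dfn A (fun v => X (t v)).
Proof.
by move=> hX ht; exact: (@dfn_subst A _ (fun=> t) (fun=> ht) hX).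
Qed.

Lemma dfn2_app A (X : M -> M -> Prop) t u :
  dfn2 A X -> dterm A t -> dterm A u -> dfn A (fun v => X (t v) (u v)).
Proof.
move=> hX ht hu; apply: (@dfn_subst A _ (fun k => if k is 0 then t else u)) hX.
by case.
Qed.

Lemma dfn_eq A t u : dterm A t -> dterm A u -> dfn A (fun v => t v = u v).
Proof.
apply: dfn2_app; exists 2, (FEq (TVar L ord0) (TVar L ord_max)).
by exists (fun i => inl (val i)); split.
Qed.

Lemma dfn_not A P : dfn A P -> dfn A (fun v => ~ P v).
Proof.
move=> [N [phi [s [sA Ps]]]]; exists N, (FNot phi), s; split=> // v.
by rewrite Ps.
Qed.

(** The two formulas keep disjoint blocks of variables; variables of the environment are shared only
    through the instantiation. *)
Lemma dfn_and A P Q : dfn A P -> dfn A Q -> dfn A (fun v => P v /\ Q v).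
Proof.
move=> [N [phi [s [sA Ps]]]] [N' [psi [s' [sA' Qs]]]].
exists (N + N')%N, (FAnd (rename phi (@lshift N N')) (rename psi (@rshift N N'))).
exists (fun i => match fintype.split i with inl j => s j | inr j => s' j end).
split=> [i|v]; first by case: (fintype.split i).
rewrite /= !sat_rename Ps Qs; congr (_ /\ _); congr sat; apply/funext => i /=.
  by rewrite (unsplitK (inl i)).
by rewrite (unsplitK (inr i)).
Qed.

(** All slots filled by variable 0 of the environment merge into the bound variable; the other
    indices move down by one. *)
Lemma dfn_ex A (Q : (nat -> M) -> M -> Prop) :
  dfn A (fun v => Q (fun k => v k.+1) (v 0)) ->
  dfn A (fun v => exists a, Q v a).
Proof.
move=> [N [phi [s [sA Qs]]]].
exists N, (FEx (rename phi (fun i => if s i is inl 0 then ord0 else lift ord0 i))).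
(* Slots with index 0 are bound by now, so the value [0.-1] given to them is never read. *)
exists (fun i => if s i is inl k then inl k.-1 else s i); split=> [i|v].
  by case: (s i) (sA i).
rewrite /=; congr ex; apply/funext => a; rewrite sat_rename.
rewrite [LHS](Qs (fun k => if k is k'.+1 then v k' else a)); congr sat.
apply/funext => i /=; rewrite /env_cons.
by case E: (s i) => [[|k]|b]; rewrite ?unlift_none ?liftK /= ?E.
Qed.

Lemma dfn_or A P Q : dfn A P -> dfn A Q -> dfn A (fun v => P v \/ Q v).
Proof.
move=> hP hQ; apply: (@dfn_ext A (fun v => ~ (~ P v /\ ~ Q v))).
  by move=> v; rewrite -not_orP; split=> [/contrapT|? ?].
by apply/dfn_not/dfn_and; exact: dfn_not.
Qed.

Lemma dfn_imp A P Q : dfn A P -> dfn A Q -> dfn A (fun v => P v -> Q v).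
Proof.
move=> hP hQ; apply: (@dfn_ext A (fun v => ~ P v \/ Q v)).
  by move=> v; rewrite implyE.
by apply: dfn_or => //; exact: dfn_not.
Qed.

Lemma dfn_all A (Q : (nat -> M) -> M -> Prop) :
  dfn A (fun v => Q (fun k => v k.+1) (v 0)) ->
  dfn A (fun v => forall a, Q v a).
Proof.
move=> hQ; apply: (@dfn_ext A (fun v => ~ exists a, ~ Q v a)).
  by move=> v; rewrite existsNP; split=> [/contrapT|? ?].
by apply/dfn_not/dfn_ex/dfn_not.
Qed.

Lemma dfn_mono A B P : A `<=` B -> dfn A P -> dfn B P.
Proof.
move=> AB [N [phi [s [sA Ps]]]]; exists N, phi, s; split=> // i.
by case: (s i) (sA i) => //= a /AB.
Qed.

Lemma dfn_finite A P : dfn A P ->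
  exists Y : set M, [/\ finite_set Y, Y `<=` A & dfn Y P].
Proof.
move=> [N [phi [s [sA Ps]]]]; exists (\bigcup_i [set a | s i = inr a]); split.
- apply: bigcup_finite => // i _; case: (s i) => [k|a].
    by apply: (@sub_finite_set _ _ set0) => // b.
  by apply: (@sub_finite_set _ _ [set a]) => // b [->].
- by move=> a [i _ sia]; have := sA i; rewrite sia.
- exists N, phi, s; split=> // i; case E: (s i) => //=; by exists i.
Qed.

(** A slot holding a parameter outside [A] can only hold [b]; such slots become the first argument
    of [Q]. *)
Lemma dfn1_abstract A b (X : M -> Prop) : dfn1 (A `|` [set b]) X ->
  exists2 Q : M -> M -> Prop, dfn2 A Q & X = Q b.
Proof.
move=> [N [phi [s [sA Xs]]]].
pose s' i : nat + M := match s i with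
  | inl k => inl 1 | inr a => if pselect (A a) then inr a else inl 0 end.
exists (fun y x =>
  sat S phi (fun i => lookup (fun k => if k is 0 then y else x) (s' i))).
  exists N, phi, s'; split=> [i|v].
    by rewrite /s'; case: (s i) => //= a; case: pselect.
  congr sat; apply/funext => i; rewrite /s'.
  by case: (s i) => //= a; case: pselect.
apply/funext => x; rewrite (Xs (fun=> x)); congr sat; apply/funext => i.
rewrite /s'; case: (s i) (sA i) => //= a; case: pselect => //= nAa.
by move=> [].
Qed.

End Definability.

(** * Translation between L(A)-formulas and instantiated L-formulas *)

Section ParameterLanguage.
Variables (L : language) (M : Type) (S : structure L M) (A : set M).
Local Notation LA := (lang_with L A).
Local Notation SA := (struct_with S A).

Fixpoint subst_term n m (f : 'I_n -> term LA m) (t : term L n) : term LA m :=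
  match t with
  | TVar i => f i
  | TApp k g args =>
      TApp (inl g : fun_sym LA k) (fun j => subst_term f (args j))
  end.

Definition lift_subst n m (f : 'I_n -> term LA m) (i : 'I_n.+1) :
    term LA m.+1 :=
  if unlift ord0 i is Some j then rename_term (lift ord0) (f j)
  else TVar LA ord0.

Fixpoint subst n (phi : formula L n) :
    forall m, ('I_n -> term LA m) -> formula LA m :=
  match phi with
  | FEq _ s t => fun m f => FEq (subst_term f s) (subst_term f t)
  | FRel _ k r args => fun m f =>
      FRel (r : rel_sym LA k) (fun j => subst_term f (args j))
  | FNot _ p => fun m f => FNot (subst p f)
  | FAnd _ p q => fun m f => FAnd (subst p f) (subst q f)
  | FEx _ p => fun m f => FEx (subst p (lift_subst f))
  end.

Lemma eval_subst n m (f : 'I_n -> term LA m) (t : term L n) v :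
  Defs.eval SA v (subst_term f t) = Defs.eval S (fun i => Defs.eval SA v (f i)) t.
Proof. by elim: t => //= k g args IH; congr fun_interp; apply/funext. Qed.

Lemma sat_subst n (phi : formula L n) m (f : 'I_n -> term LA m) v :
  sat SA (subst phi f) v = sat S phi (fun i => Defs.eval SA v (f i)).
Proof.
elim: phi m f v => //= {n} [n s t|n k r args|n p IH|n p IHp q IHq|n p IH] m f v.
- by rewrite !eval_subst.
- by congr rel_interp; apply/funext => j; rewrite eval_subst.
- by rewrite IH.
- by rewrite IHp IHq.
congr ex; apply/funext => a; rewrite IH; congr sat; apply/funext => i.
rewrite /env_cons /lift_subst.
case: (unliftP ord0 i) => [j|] _ /=; last by rewrite /env_cons unlift_none.
rewrite eval_rename; congr Defs.eval; apply/funext => l /=.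
by rewrite /env_cons liftK.
Qed.

Definition tdfn (T : (nat -> M) -> M) : Prop :=
  exists N (t : term L N) (s : 'I_N -> nat + M), (forall i, over A (s i)) /\
    forall v, T v = Defs.eval S (fun i => lookup v (s i)) t.

(** The disjoint union of the variable blocks of the terms, enumerated by [enum_rank], serves all of
    them. *)
Lemma common_parameters k (T : 'I_k -> (nat -> M) -> M) :
  (forall j, tdfn (T j)) ->
  exists N (t : 'I_k -> term L N) (s : 'I_N -> nat + M),
    (forall i, over A (s i)) /\
    forall v j, T j v = Defs.eval S (fun i => lookup v (s i)) (t j).
Proof.
move=> /fin_all_exists[N] /fin_all_exists[t] /fin_all_exists[s] sP.
pose I := {j : 'I_k & 'I_(N j)}.
exists #|{: I}|, (fun j => rename_term (fun i => enum_rank (Tagged _ i : I)) (t j)).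
exists (fun u => let x : I := enum_val u in s (tag x) (tagged x)).
split=> [u|v j]; first by have [] := sP (tag (enum_val u)).
have [_ ->] := sP j; rewrite eval_rename; congr Defs.eval.
by apply/funext => i /=; rewrite enum_rankK.
Qed.

Lemma tdfn_term n (t : term LA n) :
  tdfn (fun v => Defs.eval SA (fun i : 'I_n => v i) t).
Proof.
elim: t => [i|k [g|c] args /common_parameters[N [t [s [sA ts]]]]] /=.
- by exists 1, (TVar L ord0), (fun=> inl (val i)).
- by exists N, (TApp g t), s; split=> // v /=; congr fun_interp; apply/funext.
- exists 1, (TVar L ord0), (fun=> inr (const_val c)); split=> //= _.
  by case: c.
Qed.

Lemma dfn_sat n (phi : formula LA n) :
  dfn S A (fun v => sat SA phi (fun i => v i)).
Proof.
elim: phi => {n} [n t u|n k r args|n p IH|n p IHp q IHq|n p IH] /=.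
- have [|N [x [s [sA xs]]]] := @common_parameters 2
      (fun j v => Defs.eval SA (fun i : 'I_n => v i) (if j == ord0 then t else u)).
    by move=> j; case: ifP => _; exact: tdfn_term.
  exists N, (FEq (x ord0) (x ord_max)), s; split=> // v /=.
  by rewrite -(xs v ord0) -(xs v ord_max).
- have [j|N [x [s [sA xs]]]] := @common_parameters k
      (fun j v => Defs.eval SA (fun i : 'I_n => v i) (args j)).
    exact: tdfn_term.
  exists N, (FRel (r : rel_sym L k) x), s; split=> // v /=.
  by congr rel_interp; apply/funext => j; rewrite xs.
- exact: dfn_not.
- exact: dfn_and.
- apply: dfn_ex; apply: dfn_ext IH => v.
  suff -> : env_cons (v 0) (fun i : 'I_n => v i.+1) = (fun i : 'I_n.+1 => v i) by [].
  by apply/funext => i; rewrite /env_cons; case: unliftP => [j|] ->.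
Qed.

Lemma dfn1_solution_set (phi : formula LA 1) : dfn1 S A (solution_set S phi).
Proof.
apply: dfn_ext (dfn_sat phi) => v; rewrite /solution_set /=.
suff -> : (fun i : 'I_1 => v i) = (fun=> v 0) by [].
by apply/funext => i; rewrite ord1.
Qed.

Lemma solution_set_dfn1 (X : set M) : dfn1 S A X ->
  exists phi : formula LA 1, X = solution_set S phi.
Proof.
move=> [N [phi [s [sA Xs]]]].
have /fin_all_exists[f fs] i : exists t : term LA 1,
    forall x : M, Defs.eval SA (fun=> x) t = lookup (fun=> x) (s i).
  case: (s i) (sA i) => [k _|a /= Aa]; first by exists (TVar LA ord0).
  by exists (TApp (inr (Const Aa) : fun_sym LA 0) (fun=> TVar LA ord0)).
exists (subst phi f); apply/funext => x; rewrite /solution_set /= sat_subst.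
by rewrite (Xs (fun=> x)); congr sat; apply/funext => i; rewrite fs.
Qed.

End ParameterLanguage.

(** The hypotheses on the order in a form invariant under reversing it, so that
    every one-sided statement below also yields its mirror image. *)
Record tame (L : language) (M : Type) (S : structure L M)
    (lt : M -> M -> Prop) : Prop := Tame {
  tame_irr : forall x, ~ lt x x;
  tame_trans : forall y x z, lt x y -> lt y z -> lt x z;
  tame_total : forall x y, [\/ lt x y, x = y | lt y x];
  tame_dense : forall x y, lt x y -> exists z, lt x z /\ lt z y;
  tame_below : forall x, exists y, lt y x;
  tame_above : forall x, exists y, lt x y;
  tame_dfn : dfn2 S setT lt;
  tame_sup : forall X b, dfn1 S setT X -> (exists x, X x) ->
    (forall x, X x -> ~ lt b x) ->
    exists s, (forall x, X x -> ~ lt s x) /\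
      forall c, lt c s -> exists x, X x /\ lt c x;
  tame_inf : forall X b, dfn1 S setT X -> (exists x, X x) ->
    (forall x, X x -> ~ lt x b) ->
    exists s, (forall x, X x -> ~ lt x s) /\
      forall c, lt s c -> exists x, X x /\ lt x c;
  tame_right : forall X a, dfn1 S setT X -> exists b, lt a b /\
    ((forall x, lt a x -> lt x b -> X x) \/
     (forall x, lt a x -> lt x b -> ~ X x));
  tame_left : forall X a, dfn1 S setT X -> exists b, lt b a /\
    ((forall x, lt b x -> lt x a -> X x) \/
     (forall x, lt b x -> lt x a -> ~ X x)) }.

(** Empty interior; for definable sets this means discrete and closed. *)
Definition thin (M : Type) (lt : M -> M -> Prop) (X : M -> Prop) : Prop :=
  forall a b, lt a b -> exists x, lt a x /\ lt x b /\ ~ X x.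

(** * Automation for definability and for linear orders *)

Ltac dterm := first [exact: dterm_var | exact: dterm_cst I].

Ltac dfn_step :=
  cbv beta;
  match goal with
  | H : dfn2 _ _ ?X |- dfn _ _ (fun v => ?X (@?t v) (@?u v)) =>
      apply: (dfn2_app H); dterm
  | H : dfn1 _ _ ?X |- dfn _ _ (fun v => ?X (@?t v)) =>
      apply: (dfn1_app H); dterm
  | H : tame _ ?X |- dfn _ _ (fun v => ?X (@?t v) (@?u v)) =>
      apply: (dfn2_app (tame_dfn H)); dterm
  | |- dfn _ _ (fun v => _ = _) => apply: dfn_eq; dterm
  | |- _ => first
    [ apply: dfn_and | apply: dfn_or | apply: dfn_not
    | apply: dfn_ex | apply: dfn_imp | apply: dfn_all ]
  end.

Ltac dfn := rewrite /dfn1 /dfn2 /thin; repeat dfn_step.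

Ltac order_step h :=
  match goal with
  | H : ?lt ?x ?x |- _ => by case: (tame_irr h H)
  | H1 : ?lt ?x ?y, H2 : ?lt ?y ?z |- _ =>
      lazymatch goal with
      | _ : lt x z |- _ => fail
      | _ => have := tame_trans h H1 H2; intro
      end
  end.

Ltac order_neg h :=
  match goal with
  | H : ~ ?lt ?a ?b |- _ => let K := fresh in
      have K := tame_total h a b; case: K => K;
      [by case: (H K) | clear H; try subst | clear H]
  end.

(** Negated comparisons are split by totality, then transitivity is saturated until irreflexivity is
    violated. *)
Ltac order h :=
  match goal with
  | |- False => idtac
  | |- ~ _ => intro
  | |- ?lt ?x ?y => apply: contrapT => ?
  end;
  cbv beta in *; repeat order_neg h; repeat order_step h; fail.

(** * Thin sets and unions of chains of thin sets *)

Section Thin.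
Variables (L : language) (M : Type) (S : structure L M) (lt : M -> M -> Prop).
Hypothesis h : tame S lt.
Local Notation "x <~ y" := (lt x y) (at level 70).
Local Notation dfn1 := (dfn1 S setT).
Local Notation dfn2 := (dfn2 S setT).

Lemma tame_dual : tame S (fun x y => y <~ x).
Proof.
have [irr trans total dense below above dlt sup inf right left] := h.
split=> //.
- by move=> y x z yx zy; exact: trans yx.
- by move=> x y; case: (total x y) => ?; [exact: Or33|exact: Or32|exact: Or31].
- by move=> x y /dense[z [? ?]]; exists z.
- by dfn.
- move=> X a dX; have [b [ba H]] := left X a dX; exists b; split=> //.
  by case: H => H; [left|right] => x xa bx; exact: H.
- move=> X a dX; have [b [ab H]] := right X a dX; exists b; split=> //.
  by case: H => H; [left|right] => x xb ax; exact: H.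
Qed.

Lemma thin_dual X : thin (fun x y => y <~ x) X <-> thin lt X.
Proof.
by split=> tX a b /tX[x [? [? ?]]]; exists x.
Qed.

Lemma exists_below2 a b c : a <~ b -> a <~ c ->
  exists m, a <~ m /\ forall x, x <~ m -> x <~ b /\ x <~ c.
Proof.
move=> ab ac; have [bc|<-|cb] := tame_total h b c.
- by exists b; split=> // x xb; split=> //; order h.
- by exists b.
- by exists c; split=> // x xb; split=> //; order h.
Qed.

Lemma thin_sub (X Y : M -> Prop) :
  (forall x, X x -> Y x) -> thin lt Y -> thin lt X.
Proof.
by move=> XY tY a b /tY[x [? [? nY]]]; exists x; split=> //; split=> // /XY.
Qed.

Lemma thin_subsingleton (X : M -> Prop) :
  (forall x y, X x -> X y -> x = y) -> thin lt X.
Proof.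
move=> X1 a b ab; have [z [az zb]] := tame_dense h ab.
have [w [aw wz]] := tame_dense h az.
have [Xz|nXz] := pselect (X z); last by exists z.
exists w; split=> //; split=> [|Xw]; first by order h.
by move: wz; rewrite (X1 w z)// => /(tame_irr h).
Qed.

Lemma thin_right X a : dfn1 X -> thin lt X ->
  exists b, a <~ b /\ forall x, a <~ x -> x <~ b -> ~ X x.
Proof.
move=> dX tX; have [b [ab [Xab|nX]]] := tame_right h a dX; last by exists b.
by have [x [ax [xb []]]] := tX _ _ ab; exact: Xab.
Qed.

Lemma thin_or X Y : dfn1 X -> dfn1 Y -> thin lt X -> thin lt Y ->
  thin lt (fun x => X x \/ Y x).
Proof.
move=> dX dY tX tY a b ab.
have [c [ac nX]] := thin_right a dX tX; have [d [ad nY]] := thin_right a dY tY.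
have [e [ae eE]] := exists_below2 ab ac; have [m [am mE]] := exists_below2 ae ad.
have [x [ax /mE[/eE[xb xc] xd]]] := tame_dense h am.
by exists x; split=> //; split=> // -[]; [exact: nX|exact: nY].
Qed.

Lemma not_thinP X : ~ thin lt X ->
  exists a b, a <~ b /\ forall x, a <~ x -> x <~ b -> X x.
Proof.
move=> nX; apply: contrapT => nE; apply: nX => a b ab; apply: contrapT => nx.
apply: nE; exists a, b; split=> // x ax xb; apply: contrapT => nXx.
by apply: nx; exists x.
Qed.

Lemma fills_right X a : dfn1 X ->
  (forall b, a <~ b -> exists x, a <~ x /\ x <~ b /\ X x) ->
  exists b, a <~ b /\ forall x, a <~ x -> x <~ b -> X x.
Proof.
move=> dX acc; have [b [ab [Xab|nX]]] := tame_right h a dX; first by exists b.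
by have [x [ax [xb /nX []]]] := acc _ ab.
Qed.

(** The infimum of the part of [X] beyond [a] exceeds [a], because [X] avoids an interval to the
    right of [a]; it is attained, because [X] also avoids an interval to its own right. *)
Lemma thin_first X a x : dfn1 X -> thin lt X -> a <~ x -> X x ->
  exists z, a <~ z /\ ~ x <~ z /\ X z /\ forall y, a <~ y -> y <~ z -> ~ X y.
Proof.
move=> dX tX ax Xx.
have dY : dfn1 (fun y => a <~ y /\ X y) by dfn.
have [||z [zlb zinf]] := tame_inf h (b := a) dY.
- by exists x.
- by move=> y [ay _]; order h.
have [b [ab nXb]] := thin_right a dX tX.
have zb : ~ z <~ b.
  by move=> /zinf[y [[ay Xy] yb]]; exact: nXb Xy.
exists z; split; first by order h.
split; first by apply: zlb.
split; last by move=> y ay yz Xy; exact: (zlb y).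
apply: contrapT => nXz.
have [c [zc nXc]] := thin_right z dX tX.
have [y [[ay Xy] yc]] := zinf _ zc.
have [zy|zy|yz] := tame_total h z y.
- exact: nXc Xy.
- by rewrite -zy in Xy.
- exact: zlb yz.
Qed.

(* The points at which the chain is "entered for the first time" accumulate at
   the left endpoint of any interval covered by the union. *)
Lemma thin_chain (Y : M -> M -> Prop) : dfn2 Y ->
  (forall d e, (forall x, Y d x -> Y e x) \/ (forall x, Y e x -> Y d x)) ->
  (forall d, thin lt (Y d)) -> thin lt (fun x => exists d, Y d x).
Proof.
move=> dY chain tY; apply: contrapT => /not_thinP[a [b [ab cover]]].
have dYd d : dfn1 (Y d) by dfn.
pose R x := exists d, Y d x /\ forall y, a <~ y -> y <~ x -> ~ Y d y.
have dR : dfn1 R by rewrite /R; dfn.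
have [|c [ac Rc]] := fills_right (a := a) dR.
  move=> c ac; have [m [am mE]] := exists_below2 ab ac.
  have [x [ax /mE[xb xc]]] := tame_dense h am.
  have [d Ydx] := cover x ax xb.
  have [z [az [xz [Ydz zmin]]]] := thin_first (dYd d) (tY d) ax Ydx.
  exists z; split=> //; split; first by order h.
  by exists d.
(* A member first entered at a point [x] that [Y d0] misses contains [x] but not [x0], so it is not
   comparable with [Y d0]. *)
have [x0 [ax0 x0c]] := tame_dense h ac.
have [d0 [Yd0 _]] := Rc x0 ax0 x0c.
have [x [x0x [xc nYx]]] := tY d0 _ _ x0c.
have [|d [Yd dmin]] := Rc x _ xc; first by order h.
have [sub|sub] := chain d d0; first exact/nYx/sub.
exact: dmin (sub _ Yd0).
Qed.

End Thin.

(** * Unions of thin sets indexed by a thin set *)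

Section ThinUnion.
Variables (L : language) (M : Type) (S : structure L M).
Local Notation dfn1 := (dfn1 S setT).
Local Notation dfn2 := (dfn2 S setT).

(** [Y e] keeps the indices beyond [c] and up to [e]. These unions form a chain in [e], so it
    suffices that each is thin; a failure is traced to the infimum [e0] of the bad [e]. *)
Lemma thin_union_right (lt : M -> M -> Prop) D X c : tame S lt ->
  dfn1 D -> dfn2 X -> thin lt D -> (forall d, D d -> thin lt (X d)) ->
  thin lt (fun x => exists d, D d /\ lt c d /\ X d x).
Proof.
move=> h dD dX tD tX.
pose Y e x := exists d, D d /\ lt c d /\ ~ lt e d /\ X d x.
have dY : dfn2 Y by rewrite /Y; dfn.
have dYe e : dfn1 (Y e) by dfn.
suff tY e : thin lt (Y e).
  apply: thin_sub (thin_chain h dY _ tY); last first.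
    move=> d e; have [de|<-|ed] := tame_total h d e; [left|by left|right];
      move=> x [i [Di [ci [di Xi]]]]; exists i; do !split=> //; order h.
  by move=> x [d [Dd [cd Xd]]]; exists d, d; do !split=> //; order h.
have Yc x : ~ Y c x by move=> [d [_ [cd [nd _]]]].
apply: contrapT => nYe.
pose E e := exists a b, lt a b /\ forall x, lt a x -> lt x b -> Y e x.
have dE : dfn1 E by rewrite /E; dfn.
have EP e' : E e' <-> ~ thin lt (Y e').
  split=> [[a [b [ab abY]]] t|/not_thinP//].
  by have [x [ax [xb []]]] := t _ _ ab; exact: abY.
have Ec e' : E e' -> ~ lt e' c.
  move=> [a [b [ab abY]]] ec; have [x [ax xb]] := tame_dense h ab.
  by have [d [_ [cd [nd _]]]] := abY x ax xb; order h.
have [|e0 [e0lb e0inf]] := tame_inf h dE _ Ec; first by exists e; apply/EP.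
(* As [D] is thin, it has no point between [e2] and [e1] except possibly [e0]. *)
have [e1 [e01 De1]] := thin_right h e0 dD tD.
have [e2 [e20 De2]] := thin_right (tame_dual h) e0 dD ((thin_dual _ _).2 tD).
have [e3 [Ee3 e31]] := e0inf _ e01.
(* No index lies beyond [e0] up to [e3], so the bad [Y e3] is contained in [Y e0]. *)
have /EP nY0 : E e0.
  apply/EP => t0; move/EP: Ee3; apply; apply: thin_sub t0 => x [d [Dd [cd [d3 Xd]]]].
  exists d; do !split=> //; move=> e0d; apply: (De1 d) => //.
  by order h.
(* [Y e2] is still thin, and passing from [e2] to [e0] adds at most the member at [e0]. *)
apply: nY0.
have tY2 : thin lt (Y e2) by apply: contrapT => /EP/e0lb.
have tX0 : thin lt (fun x => D e0 /\ X e0 x).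
  have [De0|nDe0] := pselect (D e0); last by apply: thin_subsingleton h _ _ => ? ? [].
  by apply: thin_sub (tX _ De0) => x [].
apply: thin_sub (thin_or h (dYe e2) _ tY2 tX0); last first.
  by apply: (@dfn_and _ _ _ _ (fun v => D e0)); dfn.
move=> x [d [Dd [cd [d0 Xd]]]].
have [?|de|?] := tame_total h d e0; [left|by right; rewrite -de|by []].
exists d; do !split=> //; move=> e2d; exact: (De2 d).
Qed.

(** The indices are cut at the left end of the interval under test; those below it are treated in
    the reversed order. *)
Lemma thin_union (lt : M -> M -> Prop) D X : tame S lt ->
  dfn1 D -> dfn2 X -> thin lt D -> (forall d, D d -> thin lt (X d)) ->
  thin lt (fun x => exists d, D d /\ X d x).
Proof.
move=> h dD dX tD tX a b ab.
have tR := @thin_union_right _ _ _ a h dD dX tD tX.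
have tL := @thin_union_right _ _ _ a (tame_dual h) dD dX ((thin_dual _ _).2 tD)
  (fun d Dd => (thin_dual _ _).2 (tX d Dd)).
have tA : thin lt (fun x => D a /\ X a x).
  have [Da|nDa] := pselect (D a); last by apply: thin_subsingleton h _ _ => ? ? [].
  by apply: thin_sub (tX _ Da) => x [].
have tU : thin lt (fun x => ((exists d, D d /\ lt a d /\ X d x) \/
    (exists d, D d /\ lt d a /\ X d x)) \/ (D a /\ X a x)).
  apply: (thin_or h) => //; last first.
  - apply: (thin_or h) => //; last exact/thin_dual; by dfn.
  - by apply: (@dfn_and _ _ _ _ (fun v => D a)); dfn.
  - by dfn.
have [x [ax [xb nX]]] := tU _ _ ab; exists x; do !split=> //.
move=> [d [Dd Xd]]; apply: nX.
have [?|de|?] := tame_total h d a; [left; right|right|left; left]; try by exists d.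
by rewrite -de.
Qed.

End ThinUnion.

(** * The monotonicity theorem, for definable weak orders *)

Section Monotonicity.
Variables (L : language) (M : Type) (S : structure L M).
Local Notation dfn1 := (dfn1 S setT).
Local Notation dfn2 := (dfn2 S setT).

(** [p x y] stands for [f x < f y]; only the weak order given by [f] is used. *)
Definition weak_order (p : M -> M -> Prop) : Prop :=
  (forall x y, p x y -> ~ p y x) /\ (forall x y z, p x z -> p x y \/ p y z).

Definition decreasing_on (lt p : M -> M -> Prop) a b : Prop :=
  forall x y, lt a x -> lt x y -> lt y b -> p y x.

Lemma weak_order_dual p : weak_order p -> weak_order (fun x y => p y x).
Proof.
move=> [asym ntrans]; split=> [x y ? ?|x y z]; first exact: (asym y x).
by move=> /ntrans-/(_ y)[]; [right|left].
Qed.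

Lemma weak_order_trans p x y z : weak_order p -> p x y -> p y z -> p x z.
Proof.
by move=> [asym ntrans] xy yz; case: (ntrans _ z _ xy) => // /(asym _ _ yz).
Qed.

Lemma weak_order_le_lt p x y z : weak_order p -> ~ p y x -> p y z -> p x z.
Proof. by move=> [asym ntrans] yx /(ntrans _ x)[]. Qed.

Lemma weak_order_lt_le p x y z : weak_order p -> p x y -> ~ p z y -> p x z.
Proof. by move=> [asym ntrans] /(ntrans _ z)[]. Qed.

(** Let [s] be the infimum of the points beyond [x] where f is not below f x. Local decrease at [x]
    gives x < s, on the left of [s] it gives f s < f x, and on the right of [s] it carries this past
    [s]. *)
Lemma locally_decreasing lt p a b : tame S lt -> dfn2 p -> weak_order p ->
  (forall z, lt a z -> lt z b ->
    (exists c, lt c z /\ forall y, lt c y -> lt y z -> p z y) /\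
    (exists c, lt z c /\ forall y, lt z y -> lt y c -> p y z)) ->
  decreasing_on lt p a b.
Proof.
move=> h dp wp loc x y ax xy yb; apply: contrapT => nyx.
have dX : dfn1 (fun w => lt x w /\ ~ p w x) by dfn.
have [||s [slb sinf]] := tame_inf h (b := x) dX.
- by exists y.
- by move=> w [xw _]; order h.
have ys : ~ lt y s by apply: slb.
have [_ [c [xc xcp]]] := loc x ax ltac:(order h).
have sc : ~ lt s c.
  by move=> /sinf[w [[xw nwx] wc]]; exact/nwx/xcp.
have xs : lt x s by order h.
have [[e [es esp]] [f [sf sfp]]] := loc s ltac:(order h) ltac:(order h).
have [m [mx mE]] := exists_below2 (tame_dual h) es xs.
have [w [mw ws]] := tame_dense h mx.
have [ew xw] := mE _ mw.
have psx : p s x.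
  apply: (weak_order_trans wp (esp w ew ws)); apply: contrapT => nwx.
  by apply: (slb w).
have [z [[xz nzx] zf]] := sinf _ sf.
have [zs|zs|sz] := tame_total h z s; first by apply: (slb z).
  by rewrite zs in nzx.
by apply: nzx; apply: weak_order_trans (psx); auto.
Qed.

(* [z] is produced as the infimum of [{y > e | f y <= f x}]. *)
Lemma drop_or_decreasing lt p e e' : tame S lt -> dfn2 p -> weak_order p ->
  lt e e' ->
  (forall x, lt e x -> lt x e' ->
    exists b, lt e b /\ forall y, lt e y -> lt y b -> p x y) ->
  exists a b, ~ lt a e /\ ~ lt e' b /\ lt a b /\
    (decreasing_on lt p a b \/
     forall z, lt a z -> lt z b -> exists x,
       (forall y, lt e y -> ~ lt z y -> p x y) /\
       exists c, lt z c /\ forall y, lt z y -> lt y c -> ~ p x y).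
Proof.
move=> h dp wp ee' G.
pose Z z := exists x, (forall y, lt e y -> lt y z -> p x y) /\
  (forall w, lt z w -> exists y, lt e y /\ lt y w /\ ~ p x y).
have dZ : dfn1 Z by rewrite /Z; dfn.
have [|c [ec Zc]] := fills_right h (a := e) dZ.
  move=> c ec; have [m [em mE]] := exists_below2 h ec ee'.
  have [x [ex /mE[xc xe']]] := tame_dense h em.
  have dX : dfn1 (fun y => lt e y /\ ~ p x y).
    by apply: dfn_and; first dfn; apply: dfn_not; dfn.
  have nxx : ~ p x x by move=> xx; exact: (wp.1 x x).
  have [||z [zlb zinf]] := tame_inf h (b := e) dX.
  - by exists x.
  - by move=> y [ey _]; order h.
  have [b [eb xb]] := G x ex xe'.
  have zb : ~ lt z b by move=> /zinf[y [[ey ny] yb]]; exact/ny/xb.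
  have xz : ~ lt x z by apply: zlb.
  exists z; split; first by order h.
  split; first by order h.
  exists x; split.
    by move=> y ey yz; apply: contrapT => nxy; exact: (zlb y).
  by move=> w /zinf[y [[ey ny] yw]]; exists y.
(* If [P] holds to the right of [e1], f decreases there. If it fails at [z], then f x < f z for the
   [x] given by [Z z], so the return to f x or below happens just after [z]. *)
pose P z := forall y, lt e y -> lt y z -> p z y.
have dP : dfn1 P by rewrite /P; dfn.
have [m [em mE]] := exists_below2 h ec ee'.
have [e1 [ee1 e1m]] := tame_dense h em.
have [b [e1b PnP]] := tame_right h e1 dP.
have [m' [e1m' m'E]] := exists_below2 h e1b e1m.
exists e1, m'; split; first by order h.
split.
  move=> /m'E[_ e'm]; by have [_ /(tame_irr h)] := mE _ e'm.
split=> //; case: PnP => [Pb|nP]; [left|right].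
  move=> x y e1x xy /m'E[yb _]; apply: (Pb y) => //; order h.
move=> z e1z /m'E[zb /mE[zc _]].
have [x [xl xr]] := Zc z ltac:(order h) zc.
have xz : p x z.
  apply: contrapT => nxz; apply: (nP z) => // y ey yz.
  exact: weak_order_le_lt wp nxz (xl y ey yz).
exists x; split.
  move=> y ey nzy; have [|->|//] := tame_total h y z; auto.
have dX : dfn1 (p x) by dfn.
have [f [zf [pf|nf]]] := tame_right h z dX; last by exists f.
exfalso; have [y [ey [yf nxy]]] := xr _ zf; apply: nxy.
by have [|->|] := tame_total h y z; auto.
Qed.

(** The dichotomy is applied once from the left and once in the mirror image. If both times it
    yields drops, each point has one on either side, so f is locally decreasing. *)
Lemma decreasing_subinterval lt p e e' : tame S lt -> dfn2 p -> weak_order p ->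
  lt e e' ->
  (forall x, lt e x -> lt x e' ->
    exists b, lt e b /\ forall y, lt e y -> lt y b -> p x y) ->
  exists a b, ~ lt a e /\ ~ lt e' b /\ lt a b /\ decreasing_on lt p a b.
Proof.
move=> h dp wp ee' G.
have [a [b [ae [be' [ab [dec|R]]]]]] := drop_or_decreasing h dp wp ee' G.
  by exists a, b.
have [e2 [ae2 e2b]] := tame_dense h ab.
have [||||a' [b' [ae2' [ab' [ba' R']]]]] :=
  @drop_or_decreasing (fun x y => lt y x) (fun x y => p y x) e2 a
    (tame_dual h).
- by dfn.
- exact: weak_order_dual.
- by [].
- move=> x xe2 ax.
  have dX : dfn1 (fun y => p y x) by dfn.
  have [c [ce2 [pc|nX]]] := tame_left h e2 dX.
    by exists c; split=> // y *; exact: pc.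
  (* Drops at [x] and at a later [z] give the cycle f u < f x <= f y <= f w < f v <= f u. *)
  exfalso.
  have [u [xu [t [xt xtP]]]] := R x ax ltac:(order h).
  have [m [me2 mE]] := exists_below2 (tame_dual h) ce2 xe2.
  have [z [mz ze2]] := tame_dense h me2.
  have [cz xz] := mE _ mz.
  have [w [zw [s [zs zsP]]]] := R z ltac:(order h) ltac:(order h).
  have [m1 [xm1 m1E]] := exists_below2 h xt xz.
  have [v [xv /m1E[vt vz]]] := tame_dense h xm1.
  have [m2 [zm2 m2E]] := exists_below2 h zs ze2.
  have [y [zy /m2E[ys ye2]]] := tame_dense h zm2.
  have uv : ~ p u v by exact: xtP.
  have ux : p u x by apply: xu; order h.
  have wv : p w v by apply: zw; order h.
  have wy : ~ p w y by exact: zsP.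
  have yx : ~ p y x by apply: nX => //; order h.
  by apply: uv; apply: (weak_order_trans wp ux); apply: (weak_order_le_lt wp yx);
    apply: (weak_order_le_lt wp wy).
exists b', a'; split=> //; first by order h.
split; first by order h.
split=> //; case: R' => [dec|R'].
  by move=> x y b'x xy ya'; exact: dec.
(* Just to the right of [z], f y <= f u < f z; just to the left, f z < f w <= f y. *)
apply: (locally_decreasing h dp wp) => z b'z za'.
have [u [uR [t [zt ut]]]] := R z ltac:(order h) ltac:(order h).
have [w [wL [s [sz ws]]]] := R' z za' b'z.
split.
  exists s; split=> // y sy yz; apply: weak_order_lt_le wp _ (ws y yz sy).
  by apply: wL; order h.
exists t; split=> // y zy yt; apply: weak_order_le_lt wp (ut y zy yt) _.
by apply: uR; order h.
Qed.

Definition constant_on (lt p : M -> M -> Prop) a b : Prop :=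
  forall x y, lt a x -> lt x y -> lt y b -> ~ p x y /\ ~ p y x.

(** [G] and [H] say that f lies above, resp. below, f x just after [e]. Either one holding near [e]
    gives decrease, resp. increase; if both fail near [e], f equals some f x there. *)
Lemma monotone_subinterval lt p e e' : tame S lt -> dfn2 p -> weak_order p ->
  lt e e' ->
  exists a b, ~ lt a e /\ ~ lt e' b /\ lt a b /\
    [\/ constant_on lt p a b, decreasing_on lt p a b
      | decreasing_on lt (fun x y => p y x) a b].
Proof.
move=> h dp wp ee'.
pose G x := exists b, lt e b /\ forall y, lt e y -> lt y b -> p x y.
pose H x := exists b, lt e b /\ forall y, lt e y -> lt y b -> p y x.
have dG : dfn1 G.
  by rewrite /G; apply: dfn_ex; apply: (@dfn_and _ _ _ _ (fun v => lt e (v 0)));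
    dfn.
have dH : dfn1 H by rewrite /H; dfn.
have [b [eb [Gb|nGb]]] := tame_right h e dG;
  have [m [em mE]] := exists_below2 h eb ee'.
- have [x ex /mE[xb _]|a [c [ae [cm [ac dec]]]]] :=
    decreasing_subinterval h dp wp em; first exact: Gb.
  exists a, c; split=> //; split; last by split=> //; exact: Or32.
  by move=> /(fun e'c => mE e' ltac:(order h))[_ /(tame_irr h)].
have [c [ec [Hc|nHc]]] := tame_right h e dH;
  have [m' [em' m'E]] := exists_below2 h ec em.
- have [||||a [f [ae [fm [af dec]]]]] :=
    @decreasing_subinterval lt (fun x y => p y x) e m' h; last first.
  + exists a, f; split=> //; split; last by split=> //; exact: Or33.
    move=> e'f; have [_] := m'E e' ltac:(order h).
    by move=> /mE[_ /(tame_irr h)].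
  + by move=> x ex /m'E[xc _]; exact: Hc.
  + by [].
  + exact: weak_order_dual.
  + by dfn.
have [x [ex /m'E[xc /mE[xb xe']]]] := tame_dense h em'.
have dX : dfn1 (p x) by dfn.
have dX' : dfn1 (fun y => p y x) by dfn.
have [f [ef [pf|npf]]] := tame_right h e dX; first by case: (nGb x) => //; exists f.
have [g [eg [pg|npg]]] := tame_right h e dX'; first by case: (nHc x) => //; exists g.
have [k [ek kE]] := exists_below2 h ef eg.
have [k' [ek' k'E]] := exists_below2 h ek ee'.
exists e, k'; split; first by order h.
split; first by move=> /k'E[_ /(tame_irr h)].
split=> //; apply: Or31 => y z ey yz zk'.
have [/kE[yf yg] _] := k'E y ltac:(order h).
have [/kE[zf zg] _] := k'E z zk'.
by split=> /(wp.2 _ x)[] ?;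
  [apply: (npg y)|apply: (npf z)|apply: (npg z)|apply: (npf y)] => //; order h.
Qed.

End Monotonicity.

(** * Families whose fibers in one direction are thin *)

Section ThinFibers.
Variables (L : language) (M : Type) (S : structure L M).
Local Notation dfn1 := (dfn1 S setT).
Local Notation dfn2 := (dfn2 S setT).

(** Ends are compared as cuts, so attained and unattained ends differ. Where both ends are monotone,
    a point common to two fibers lies in every fiber between them, against [tV]. *)
Lemma disjoint_subinterval lt V a b : tame S lt -> dfn2 V ->
  (forall t x y z, V t x -> V t z -> ~ lt y x -> ~ lt z y -> V t y) ->
  (forall y, thin lt (fun t => V t y)) -> lt a b ->
  exists a' b', ~ lt a' a /\ ~ lt b b' /\ lt a' b' /\
    forall t t' y, lt a' t -> lt t b' -> lt a' t' -> lt t' b' ->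
      V t y -> V t' y -> t = t'.
Proof.
move=> h dV convex tV ab.
(* comparison of the lower ends, resp. of the upper ends, of the fibers *)
pose lower t t' := exists y, V t y /\ forall z, V t' z -> lt y z.
pose upper t t' := exists y, V t' y /\ forall z, V t z -> lt z y.
have dlower : dfn2 lower by rewrite /lower; dfn.
have dupper : dfn2 upper by rewrite /upper; dfn.
have wlower : weak_order lower.
  split=> [t t' [y [Vy yV]] [z [Vz zV]]|t t' t'' [y [Vy yV]]].
    by have ? := yV z Vz; have ? := zV y Vy; order h.
  have [|nl] := pselect (lower t t'); first by left.
  right; apply: contrapT => nr; apply: nl; exists y; split=> // z Vz.
  apply: contrapT => nyz; apply: nr; exists z; split=> // w /yV yw; order h.
have wupper : weak_order upper.
  split=> [t t' [y [Vy yV]] [z [Vz zV]]|t t' t'' [y [Vy yV]]].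
    by have ? := yV z Vz; have ? := zV y Vy; order h.
  have [|nr] := pselect (upper t' t''); first by right.
  left; apply: contrapT => nl; apply: nr; exists y; split=> // z Vz.
  apply: contrapT => nzy; apply: nl; exists z; split=> // w /yV wy; order h.
have [a1 [b1 [a1a [b1b [ab1 mlower]]]]] := monotone_subinterval h dlower wlower ab.
have [a2 [b2 [a2a [b2b [ab2 mupper]]]]] := monotone_subinterval h dupper wupper ab1.
have [[al _] [au _]] := (wlower, wupper).
have ends t t' y s : lt a2 t -> lt t s -> lt s t' -> lt t' b2 ->
    V t y -> V t' y -> V s y.
  move=> a2t ts st' tb Vt Vt'.
  have a1t : lt a1 t by order h.
  have tb1 : lt t' b1 by order h.
  have sb1 : lt s b1 by order h.
  have a1s : lt a1 s by order h.
  have a2s : lt a2 s by order h.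
  have sb2 : lt s b2 by order h.
  (* Otherwise [V s] lies above [y], and its lower end exceeds those of both [V t] and [V t'], which
     monotonicity excludes. *)
  have [z [Vz nyz]] : exists z, V s z /\ ~ lt y z.
    apply: contrapT => nz.
    have yV z : V s z -> lt y z.
      by move=> Vz; apply: contrapT => nyz; apply: nz; exists z.
    have lts : lower t s by exists y.
    have lt's : lower t' s by exists y.
    case: mlower => [cst|dec|inc]; first by case: (cst t s).
      by apply: (al t s) => //; exact: dec.
    by apply: (al t' s) => //; exact: inc.
  have [w [Vw nwy]] : exists w, V s w /\ ~ lt w y.
    apply: contrapT => nz.
    have yV w : V s w -> lt w y.
      by move=> Vw; apply: contrapT => nyw; apply: nz; exists w.
    have lts : upper s t by exists y.
    have lt's : upper s t' by exists y.
    case: mupper => [cst|dec|inc]; first by case: (cst t s).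
      by apply: (au s t') => //; exact: dec.
    by apply: (au s t) => //; exact: inc.
  exact: (convex s z y w).
exists a2, b2; split; first by order h.
split; first by order h.
split=> // t t' y a2t tb a2t' t'b Vt Vt'.
have [tt'|//|t't] := tame_total h t t'.
  have [s [ts [st' []]]] := tV y _ _ tt'; exact: (ends t t').
have [s [ts [st' []]]] := tV y _ _ t't; exact: (ends t' t).
Qed.

(** Cutting the fibers at [c] bounds them from below, so that their interiors [U t] have infima and
    hence first convex components. *)
Lemma thin_thick_fibers_right lt X c : tame S lt -> dfn2 X ->
  (forall y, thin lt (fun t => X t y)) ->
  thin lt (fun t => ~ thin lt (fun y => lt c y /\ X t y)).
Proof.
move=> h dX tX; apply: contrapT => /not_thinP[a [b [ab thick]]].
pose U t y := lt c y /\ exists p q, lt p y /\ lt y q /\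
  forall z, lt p z -> lt z q -> X t z.
(* [U t] has no point up to [l] and contains all points after [l] up to [y]; hence [V t] is its
   first convex component, starting at [l]. *)
pose C t l y := lt l y /\ (forall z, ~ lt l z -> ~ U t z) /\
  forall z, lt l z -> ~ lt y z -> U t z.
pose V t y := exists l, C t l y.
have dV : dfn2 V by rewrite /V /C /U; dfn.
have UX t y : U t y -> X t y by move=> [_ [p [q [py [yq]]]]]; exact.
have VU t y : V t y -> U t y.
  by move=> [l [ly [_ lU]]]; apply: lU => //; order h.
have Vex t : lt a t -> lt t b -> exists y, V t y.
  move=> at_ tb; have /not_thinP[p [q [pq pqX]]] := thick t at_ tb.
  have dU : dfn1 (U t) by rewrite /U; dfn.
  have [||l [llb linf]] := tame_inf h (b := c) dU.
  - have [y [py yq]] := tame_dense h pq.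
    have [cy _] := pqX y py yq.
    exists y; split=> //; exists p, q; do !split=> //.
    by move=> z pz zq; have [] := pqX z pz zq.
  - by move=> y [cy _]; order h.
  have nUl : ~ U t l.
    move=> [cl [p' [q' [p'l [lq' X']]]]].
    have [m [ml mE]] := exists_below2 (tame_dual h) cl p'l.
    have [z [mz zl]] := tame_dense h ml; have [cz pz] := mE _ mz.
    apply: (llb z) => //; split=> //; exists p', q'; do !split=> //.
    by order h.
  have [r [lr [rU|rnU]]] := tame_right h l dU; last first.
    have [y [Uy yr]] := linf _ lr; have nyl := llb _ Uy; exfalso.
    have [ly|ly|//] := tame_total h l y; first exact: rnU Uy.
    by rewrite -ly in Uy.
  have [y [ly yr]] := tame_dense h lr.
  exists y, l; split=> //; split=> z; last by move=> lz nyz; apply: rU => //; order h.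
  move=> nlz Uz; have [zl|zl|//] := tame_total h z l; first exact: (llb z).
  by rewrite zl in Uz.
have convex t x y z : V t x -> V t z -> ~ lt y x -> ~ lt z y -> V t y.
  move=> Vx [l [lz [llb lU]]] nyx nzy; exists l.
  have lx : lt l x by apply: contrapT => /llb; apply; exact: VU.
  split; first by order h.
  by split=> // w lw nyw; apply: lU => //; order h.
have tV y : thin lt (fun t => V t y).
  by apply: thin_sub (tX y) => t /VU/UX.
have [a' [b' [a'a [bb' [ab' disj]]]]] := disjoint_subinterval h dV convex tV ab.
(* [W l] holds the t whose component starts at [l]: at most one by disjointness, yet together these
   sets cover the subinterval. *)
pose D l := exists t y, lt a' t /\ lt t b' /\ C t l y.
pose W l t := exists y, lt a' t /\ lt t b' /\ C t l y.
have dD : dfn1 D by rewrite /D /C /U; dfn.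
have dW : dfn2 W by rewrite /W /C /U; dfn.
have tW l : D l -> thin lt (W l).
  move=> _; apply: (thin_subsingleton h) => t t'.
  move=> [y [a't [tb' [ly [llb lU]]]]] [y' [a't' [tb'' [ly' [llb' lU']]]]].
  have [m [lm mE]] := exists_below2 h ly ly'.
  have [z [lz /mE[zy zy']]] := tame_dense h lm.
  apply: (disj t t' z) => //; exists l; split=> //; split=> // w lw nzw.
    by apply: lU => //; order h.
  by apply: lU' => //; order h.
have tD : thin lt D.
  apply: contrapT => /not_thinP[p [q [pq pqD]]].
  have [l [pl lq]] := tame_dense h pq.
  have [t [y [a't [tb' [ly [llb lU]]]]]] := pqD l pl lq.
  (* A second start [l2] is taken inside the component starting at [l]. The two components overlap,
     so t = t2, although [l2] lies in [U t] and not in [U t2]. *)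
  have [m [lm mE]] := exists_below2 h lq ly.
  have [l2 [ll2 /mE[l2q l2y]]] := tame_dense h lm.
  have [t2 [y2 [a't2 [tb'2 [ly2 [llb2 lU2]]]]]] := pqD l2 ltac:(order h) l2q.
  have [m' [lm' m'E]] := exists_below2 h ly2 l2y.
  have [z [lz /m'E[zy2 zy]]] := tame_dense h lm'.
  have tt : t = t2.
    apply: (disj _ _ z) => //.
      exists l; split; first by order h.
      by split=> // w lw nzw; apply: lU => //; order h.
    by exists l2; split=> //; split=> // w lw nzw; apply: lU2 => //; order h.
  apply: (llb2 l2); first order h.
  by rewrite -tt; apply: lU => //; order h.
have [t [a't [tb' nW]]] := thin_union h dD dW tD tW ab'.
have [y [l Cy]] := Vex t ltac:(order h) ltac:(order h).
by apply: nW; exists l; split; [exists t|]; exists y.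
Qed.

(** A thick fiber is thick above or below the cut point [a]. *)
Lemma thin_thick_fibers lt X : tame S lt -> dfn2 X ->
  (forall y, thin lt (fun t => X t y)) ->
  thin lt (fun t => ~ thin lt (X t)).
Proof.
move=> h dX tX a b ab.
have tR := thin_thick_fibers_right a h dX tX.
have tL := thin_thick_fibers_right a (tame_dual h) dX
  (fun y => (thin_dual _ _).2 (tX y)).
have [||x [ax [xb nx]]] := thin_or h _ _ tR ((thin_dual _ _).1 tL) ab.
- by rewrite /thin; dfn.
- by rewrite /thin; dfn.
exists x; split=> //; split=> // nt; apply: nx; apply: contrapT.
rewrite not_orE => -[/contrapT tr /contrapT tl]; apply: nt.
have tU : thin lt (fun y => ((lt a y /\ X x y) \/ (lt y a /\ X x y)) \/ y = a).
  apply: (thin_or h); [by dfn|by dfn| |]; last first.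
    by apply: (thin_subsingleton h) => y z -> ->.
  by apply: (thin_or h) => //; [dfn|dfn|exact/thin_dual].
apply: thin_sub tU => y Xy.
by have [?|->|?] := tame_total h y a; [left; right|right|left; left].
Qed.

End ThinFibers.

(** * Thin unions and thin fibers, definably over [A] *)

Section ParametricThin.
Variables (L : language) (M : Type) (S : structure L M) (lt : M -> M -> Prop).
Hypothesis h : tame S lt.
Variable A : set M.
Hypothesis dlt : dfn2 S A lt.

Let defT P : dfn S A P -> dfn S setT P.
Proof. exact: dfn_mono. Qed.

(** The guard replaces a set that is not thin by the empty set. *)
Lemma thin_guard X : thin lt (fun x => thin lt X /\ X x).
Proof.
have [tX|ntX] := pselect (thin lt X); first by apply: thin_sub tX => x [].
by apply: (thin_subsingleton h) => x y [/ntX].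
Qed.

Lemma thin_absorb D Q : dfn1 S A D -> dfn2 S A Q -> thin lt D ->
  let X y := exists e, D e /\ (thin lt (Q e) /\ Q e y) in
  dfn1 S A X /\ thin lt X.
Proof.
move=> dD dQ tD X.
have dX : dfn2 S A (fun e y => thin lt (Q e) /\ Q e y) by dfn.
split; first by rewrite /X; dfn.
by apply: (thin_union h (defT dD) (defT dX) tD) => e _; exact: thin_guard.
Qed.

(** Prepares exchange: in the transposed guarded family, the points with a thick fiber form a thin
    set definable over [A]. *)
Lemma thin_swap Q : dfn2 S A Q ->
  let X x y := thin lt (Q y) /\ Q y x in
  dfn2 S A X /\
  (dfn1 S A (fun x => ~ thin lt (X x)) /\ thin lt (fun x => ~ thin lt (X x))).
Proof.
move=> dQ X; have dX : dfn2 S A X by rewrite /X; dfn.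
split=> //; split; first by dfn.
by apply: (thin_thick_fibers h (defT dX)) => y; exact: thin_guard.
Qed.

Lemma dfn1_cst2 a X : dfn2 S A X -> A a -> dfn1 S A (X a).
Proof.
by move=> dX Aa; apply: (dfn2_app dX); [exact: dterm_cst|exact: dterm_var].
Qed.

End ParametricThin.

(** * From local o-minimality and the order topology to [tame] and [thin] *)

Section LocallyOMinimal.
Local Open Scope order_scope.
Variables (L : language) (lt_sym : rel_sym L 2) (d : Order.disp_t).
Variables (M : orderTopologicalType d) (S : structure L M).
Hypothesis lt_symE : forall v : 'I_2 -> M,
  rel_interp S lt_sym v <-> v ord0 < v ord_max.
Hypothesis hdlo : dense_without_endpoints M.
Hypothesis hcomplete : definably_complete S.
Hypothesis homin : locally_o_minimal S.

Local Notation lt := (fun x y : M => x < y).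

Lemma open_interval_nbhs (I : set M) a : open_interval I -> I a ->
  exists p q, [/\ p < a, a < q & forall x, p < x -> x < q -> I x].
Proof.
have [_ below above] := hdlo.
have [p0 p0a] := below a; have [q0 aq0] := above a.
move=> [i [+ -> _]]; case: i => [[[]l|[]] [[]r|[]]] //=; rewrite in_itv /=.
- by move=> _ /andP[la ar]; exists l, r; split=> // x lx xr; rewrite in_itv /= lx.
- by rewrite andbT => _ la; exists l, q0; split=> // x lx _; rewrite in_itv /= lx.
- by move=> _ ar; exists p0, r; split=> // x _ xr; rewrite in_itv.
- by move=> _ _; exists p0, q0; split.
Qed.

Lemma piece_convex (U : set M) : (exists p, U = [set p]) \/ open_interval U ->
  forall x y z, U x -> U z -> x < y -> y < z -> U y.
Proof.
move=> [[p ->] x y z -> -> xy yx|[i [_ -> _]] x y z /= xi zi xy yz].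
  by have := lt_trans xy yx; rewrite ltxx.
case: i xi zi => l r /=; rewrite !itv_boundlr => /andP[lx _] /andP[_ zr].
apply/andP; split; [apply: le_trans lx _|apply: le_trans zr];
  by rewrite bnd_simp ltW.
Qed.

(** * One-sided behaviour of finite unions of convex sets, for an order or its reverse *)

Section Dichotomy.
Variable R : M -> M -> Prop.
Hypotheses (R_trans : forall y x z, R x y -> R y z -> R x z)
  (R_total : forall x y, [\/ R x y, x = y | R y x]).

Let R_min a b c : R a b -> R a c ->
  exists m, R a m /\ forall x, R x m -> R x b /\ R x c.
Proof.
move=> ab ac; have [bc|<-|cb] := R_total b c.
- by exists b; split=> // x xb; split=> //; exact: R_trans bc.
- by exists b.
- by exists c; split=> // x xc; split=> //; exact: R_trans cb.
Qed.

(** A convex set that accumulates at [a] along [R] fills the gap up to any of its points beyond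
    [a]. *)
Lemma convex_dichotomy (U : set M) a q : R a q ->
  (forall x y z, U x -> U z -> R x y -> R y z -> U y) ->
  exists b, R a b /\
    ((forall x, R a x -> R x b -> U x) \/ (forall x, R a x -> R x b -> ~ U x)).
Proof.
move=> aq convex.
have [acc|] := pselect (forall b, R a b -> exists x, [/\ R a x, R x b & U x]).
  have [b [ab bq Ub]] := acc _ aq; exists b; split=> //; left=> x ax xb.
  have [y [ay yx Uy]] := acc _ ax; exact: convex Uy Ub yx xb.
move=> /existsNP[b /not_implyP[ab nU]]; exists b; split=> //; right=> x ax xb Ux.
by apply: nU; exists x.
Qed.

Lemma pieces_dichotomy (F : set (set M)) a q : R a q -> finite_set F ->
  (forall U, F U -> forall x y z, U x -> U z -> R x y -> R y z -> U y) ->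
  exists b, R a b /\
    ((forall x, R a x -> R x b -> (\bigcup_(U in F) U) x) \/
     (forall x, R a x -> R x b -> ~ (\bigcup_(U in F) U) x)).
Proof.
move=> aq /finite_seqP[s ->]; elim: s => [|U s IH] convex.
  by exists q; split=> //; right=> x _ _ [].
have [b [ab Hb]] := IH (fun V sV => convex V (mem_behead (s := U :: s) sV)).
have [c [ac Hc]] := convex_dichotomy aq (convex U (mem_head _ _)).
have [m [am mE]] := R_min ab ac; exists m; split=> //.
case: Hb => [bF|nbF].
  left=> x ax /mE[xb _]; have [V sV Vx] := bF x ax xb.
  by exists V => //; exact: (mem_behead (s := U :: s)).
case: Hc => [cU|ncU].
  by left=> x ax /mE[_ xc]; exists U; [exact: mem_head|exact: cU].
right=> x ax /mE[xb xc] [V /=]; rewrite inE => /predU1P[->|sV] Vx.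
  exact: ncU Vx.
by apply: (nbF x ax xb); exists V.
Qed.

Lemma trace_dichotomy (X I : set M) a q : R a q ->
  (forall x, R a x -> R x q -> I x) ->
  (forall U : set M, (exists p, U = [set p]) \/ open_interval U ->
     forall x y z, U x -> U z -> R x y -> R y z -> U y) ->
  finite_union_points_intervals (X `&` I) ->
  exists b, R a b /\
    ((forall x, R a x -> R x b -> X x) \/ (forall x, R a x -> R x b -> ~ X x)).
Proof.
move=> aq aqI convex [F [finF FP XI]].
have [b [ab Hb]] := pieces_dichotomy aq finF (fun U FU => convex U (FP U FU)).
have [m [am mE]] := R_min ab aq; exists m; split=> //; rewrite -XI in Hb.
case: Hb => Hb; [left|right] => x ax /mE[xb xq].
  by have [] := Hb x ax xb.
by move=> Xx; apply: (Hb x ax xb); split=> //; exact: aqI.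
Qed.

End Dichotomy.

Lemma locally_o_minimal_tame : tame S lt.
Proof.
have [dense below above] := hdlo.
have defX X : dfn1 S setT X -> definable S X by move=> /solution_set_dfn1.
have total (x y : M) : [\/ x < y, x = y | y < x].
  by case: (ltgtP x y) => ?; [exact: Or31|exact: Or33|exact: Or32].
have leP (x y : M) : ~ x < y -> y <= x by move/negP; rewrite -leNgt.
split=> //.
- by move=> x; rewrite ltxx.
- by move=> y x z; exact: lt_trans.
- by move=> x y /dense[z /andP[xz zy]]; exists z.
- exists 2, (FRel lt_sym (fun i => TVar L i)), (fun i => inl (val i)).
  by split=> // v; apply/propext; rewrite /= lt_symE.
- move=> X b /defX/hcomplete[[s [ub lub]] _] [x0 Xx0] Xb.
  have bub : ubound (@Fin M @` X) (@Fin M b).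
    by move=> _ [x Xx <-]; apply: leP; exact: Xb.
  case: s ub lub => [|s|] ub lub.
  + by have := ub _ (ex_intro2 _ _ x0 Xx0 erefl).
  + exists s; split=> [x Xx|c cs].
      apply/negP; rewrite -leNgt; exact: (ub _ (ex_intro2 _ _ x Xx erefl)).
    apply: contrapT => nX; suff : s <= c by rewrite leNgt cs.
    apply: (lub (@Fin M c)) => _ [x Xx <-]; apply: leP => cx.
    by apply: nX; exists x.
  + by have := lub _ bub.
- move=> X b /defX/hcomplete[_ [s [lb glb]]] [x0 Xx0] Xb.
  have blb : lbound (@Fin M @` X) (@Fin M b).
    by move=> _ [x Xx <-]; apply: leP; exact: Xb.
  case: s lb glb => [|s|] lb glb.
  + by have := glb _ blb.
  + exists s; split=> [x Xx|c cs].
      apply/negP; rewrite -leNgt; exact: (lb _ (ex_intro2 _ _ x Xx erefl)).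
    apply: contrapT => nX; suff : c <= s by rewrite leNgt cs.
    apply: (glb (@Fin M c)) => _ [x Xx <-]; apply: leP => cx.
    by apply: nX; exists x.
  + by have := lb _ (ex_intro2 _ _ x0 Xx0 erefl).
- move=> X a /defX/homin-/(_ a)[I [oI Ia XI]].
  have [p [q [pa aq pqI]]] := open_interval_nbhs oI Ia.
  apply: (trace_dichotomy _ total aq _ piece_convex XI).
    by move=> y x z; exact: lt_trans.
  by move=> x ax; apply: pqI; exact: lt_trans ax.
- move=> X a /defX/homin-/(_ a)[I [oI Ia XI]].
  have [p [q [pa aq pqI]]] := open_interval_nbhs oI Ia.
  pose gt (x y : M) := y < x.
  have gt_trans y x z : gt x y -> gt y z -> gt x z by move=> yx /lt_trans; exact.
  have gt_total x y : [\/ gt x y, x = y | gt y x].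
    by case: (total x y) => ?; [exact: Or33|exact: Or32|exact: Or31].
  have [x xa px|U UP x y z Ux Uz yx zy|b [ba H]] :=
      trace_dichotomy gt_trans gt_total (q := p) pa _ _ XI.
  + by apply: pqI => //; exact: lt_trans aq.
  + exact: (piece_convex UP Uz Ux).
  + exists b; split=> //.
    by case: H => H; [left|right] => x bx xa; exact: H.
Qed.

(** A thin definable set meets some interval around each point [a] at most in [a]. Conversely, a
    point of an interval inside [X] is not isolated in [X]. *)
Lemma thin_discrete_closed X : tame S lt -> dfn1 S setT X ->
  thin lt X <-> discrete_subset X /\ closed X.
Proof.
move=> h dX; split=> [tX|[disc _] a b ab].
  have isolated a : exists p q, [/\ p < a, a < q &
      forall x, p < x -> x < q -> X x -> x = a].
    have [q [aq qX]] := thin_right h a dX tX.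
    have [p [pa pX]] := thin_right (tame_dual h) a dX ((thin_dual _ _).2 tX).
    exists p, q; split=> // x px xq Xx.
    by have [/pX|//|/qX] := tame_total h x a; [case|case].
  split.
    (* [V] joins, over the points u of [U], the intervals in which [X] has no point other than u. *)
    move=> U; pose V := \bigcup_(u in U) \bigcup_(pq in [set pq : M * M |
      forall x, pq.1 < x -> x < pq.2 -> X x -> x = set_val u]) `]pq.1, pq.2[%classic.
    exists V.
      by apply: bigcup_open => u _; apply: bigcup_open => pq _; exact: itv_open.
    apply/seteqP; split=> u.
      move=> [w Uw [pq /= wP /=]]; rewrite in_itv /= => /andP[pu uq].
      by rewrite (_ : u = w) //; apply/val_inj/wP => //; exact: set_valP.
    move=> Uu; exists u => //; have [p [q [pu uq pqP]]] := isolated (set_val u).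
    by exists (p, q) => //=; rewrite in_itv /= pu.
  rewrite -openC openE => a nXa; rewrite /interior itv_nbhsE.
  have [p [q [pa aq pqP]]] := isolated a.
  exists `]p, q[%O; first by rewrite in_itv /= pa.
  by move=> x /=; rewrite in_itv /= => /andP[px xq] Xx; apply: nXa; rewrite -(pqP x).
apply: contrapT => nX.
have abX x : a < x -> x < b -> X x.
  by move=> ax xb; apply: contrapT => nXx; apply: nX; exists x.
have [x [ax xb]] := tame_dense h ab.
have Xx := abX x ax xb.
have [V oV VX] := disc [set u | set_val u = x].
have memV y (Xy : X y) : V y <-> y = x.
  by move/seteqP: VX => [sub sup]; split=> [|->];
    [exact: (sub (exist _ y (mem_set Xy)))|exact: (sup (exist _ x (mem_set Xx)))].
have : nbhs x V by apply: open_nbhs_nbhs; split=> //; exact: (memV x Xx).2.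
rewrite itv_nbhsE => -[i [oi xi] iV].
have [|p [q [px xq pqi]]] := @open_interval_nbhs [set` i] x _ xi.
  by exists i; split=> //; exists x.
have [m [xm mP]] := exists_below2 h xq xb.
have [y [xy /mP[yq yb]]] := tame_dense h xm.
have Vy : V y by apply/iV/pqi => //; exact: lt_trans xy.
have Xy : X y by apply: abX => //; exact: lt_trans xy.
by move: xy; rewrite ((memV y Xy).1 Vy) ltxx.
Qed.

(** The working form of discrete closure: the topology enters only through [thin]. *)
Lemma disclP A x : discl S A x <->
  exists X, [/\ dfn1 S A X, X x & thin lt X].
Proof.
have h := locally_o_minimal_tame.
have defT (X : M -> Prop) : dfn1 S A X -> dfn1 S setT X by exact: dfn_mono.
split=> [[phi [phix disc cl]]|[X [dX Xx tX]]].
  have dphi := dfn1_solution_set S phi.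
  exists (solution_set S phi); split=> //.
  by apply/thin_discrete_closed => //; exact: defT.
have [phi phiE] := solution_set_dfn1 dX; exists phi; rewrite -phiE.
by have /thin_discrete_closed[] := tX => //; exact: defT.
Qed.

(** * The pregeometry axioms for discrete closure *)

Lemma sub_discl A : A `<=` discl S A.
Proof.
move=> a Aa; apply/disclP; exists (fun x => x = a); split=> //.
  by apply: dfn_eq; [exact: dterm_var|exact: dterm_cst].
by apply: (thin_subsingleton locally_o_minimal_tame) => x y -> ->.
Qed.

Lemma discl_mono A B : A `<=` B -> discl S A `<=` discl S B.
Proof.
move=> AB x /disclP[X [dX Xx tX]]; apply/disclP; exists X; split=> //.
exact: dfn_mono dX.
Qed.

Lemma discl_finite A x : discl S A x ->
  exists Y, [/\ finite_set Y, Y `<=` A & discl S Y x].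
Proof.
move=> /disclP[X [/dfn_finite[Y [finY YA dX]] Xx tX]].
by exists Y; split=> //; apply/disclP; exists X.
Qed.

Lemma dfn2_lt A : dfn2 S A lt.
Proof.
exists 2, (FRel lt_sym (fun i => TVar L i)), (fun i => inl (val i)).
by split=> // v; apply/propext; rewrite /= lt_symE.
Qed.

(** With [b] in the thin set [D], the union of the guarded [Q e] over [D] contains [Q b], is thin
    and no longer mentions [b]. *)
Lemma discl_setU1 A b : discl S A b -> discl S (A `|` [set b]) `<=` discl S A.
Proof.
move=> /disclP[D [dD Db tD]] x /disclP[X [dX Qx tQ]].
have [Q dQ XQ] := dfn1_abstract dX; subst X.
apply/disclP; exists (fun y => exists e, D e /\ (thin lt (Q e) /\ Q e y)).
have [dU tU] := thin_absorb locally_o_minimal_tame (@dfn2_lt A) dD dQ tD.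
by split=> //; exists b.
Qed.

Lemma discl_setU_finite A Y : finite_set Y -> Y `<=` discl S A ->
  discl S (A `|` Y) `<=` discl S A.
Proof.
move=> /finite_seqP[s ->]; elim: s => [|b s IH] sA; first by rewrite set_nil setU0.
have sA' : [set` s] `<=` discl S A.
  by move=> y ys; apply: sA; exact: (mem_behead (s := b :: s)).
apply: subset_trans (IH sA').
have bA : discl S (A `|` [set` s]) b.
  by apply: discl_mono (sA b (mem_head _ _)) => y; left.
apply: subset_trans (discl_setU1 bA); apply: discl_mono => y [Ay|/=].
  by left; left.
by rewrite inE => /predU1P[->|ys]; [right|left; right].
Qed.

(** By finite character only finitely many points of the closure have to be absorbed, one at a
    time. *)
Lemma discl_idempotent A : discl S (discl S A) = discl S A.
Proof.
apply/seteqP; split; last exact: sub_discl.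
move=> x /discl_finite[Y [finY YA Yx]]; apply: (discl_setU_finite finY YA).
by apply: discl_mono Yx => y; right.
Qed.

Lemma discl_exchange A a b : (discl S (A `|` [set b]) `\` discl S A) a ->
  discl S (A `|` [set a]) b.
Proof.
move=> [/disclP[X [dX Qa tQ]] nAa].
have [Q dQ XQ] := dfn1_abstract dX; subst X.
have [dR [dT tT]] := thin_swap locally_o_minimal_tame (@dfn2_lt A) dQ.
apply/disclP; exists (fun y => thin lt (Q y) /\ Q y a); split=> //.
  apply: (dfn1_cst2 (X := fun x y => thin lt (Q y) /\ Q y x)) => //.
    by apply: dfn_mono dR => y; left.
  by right.
(* If the fiber over [a] is thick, then [a] lies in the thin set of such points, which is definable
   over [A]. *)
apply: contrapT => nt; apply: nAa; apply/disclP.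
by exists (fun x => ~ thin lt (fun y => thin lt (Q y) /\ Q y x)).
Qed.

End LocallyOMinimal.

Theorem theorem3p2 (L : language) (lt_sym : rel_sym L 2)
    (d : Order.disp_t) (M : orderTopologicalType d) (S : structure L M)
    (lt_symE : forall v : 'I_2 -> M,
      rel_interp S lt_sym v <-> (v ord0 < v ord_max)%O)
    (hdlo : dense_without_endpoints M)
    (hcomplete : definably_complete S)
    (homin : locally_o_minimal S) :
  pregeometry (discl S).
Proof.
move=> A; split.
- exact: sub_discl.
- exact: discl_idempotent.
- by move=> a b; exact: discl_exchange.
- by move=> a; exact: discl_finite.
Qed.
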